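(* Let $S$ be a set, let $\mathcal{S}$ be the metric space of simplicial complexes over $S$, let $\mathcal{S}_n$ ($n\geq0$) be its subspace of complexes all of whose elements have cardinality at most $n+1$, and let $\mathcal{S}_\infty=\bigcup_n\mathcal{S}_n$. (i) For all $n$, $\mathcal{S}_n$ is discrete. (ii) When $S$ is infinite, $\mathcal{S}_\infty$ is not dense inside $\mathcal{S}$. More specifically, $\mathcal{P}_f^*(S)$, considered as a simplicial complex, does not belong to the closure of $\mathcal{S}_\infty$, and its distance to $\mathcal{S}_\infty$ is equal to $1$. (iii) When $S$ is infinite, $\mathcal{S}_\infty$ is equal to the set of isolated points of $\mathcal{S}$.
   Context: $\mathcal{P}_f^*(S)$ is the collection of all non-empty finite subsets of $S$. A simplicial complex over $S$ is a non-empty collection $\mathcal{K}\subset\mathcal{P}_f^*(S)$ such that every non-empty subset of an element of $\mathcal{K}$ belongs to $\mathcal{K}$. $\Omega=[0,1]$ with Lebesgue measure $\lambda$. $L(\mathcal{K})$ is the set of measurable maps $f:\Omega\to S$, identified when equal almost everywhere, such that $f(\Omega)\in\mathcal{K}$, where $f(\Omega)$ denotes the set $\{s\in S : \lambda(f^{-1}(s))>0\}$ and $f$ takes its values in this set almost everywhere. The metric is $d(f,g)=\lambda(\{t\in\Omega : f(t)\neq g(t)\})$. The metric on $\mathcal{S}$ is the Hausdorff distance $d(\mathcal{K}_1,\mathcal{K}_2)=\max(\delta(\mathcal{K}_1,\mathcal{K}_2),\delta(\mathcal{K}_2,\mathcal{K}_1))$ with $\delta(\mathcal{K}_1,\mathcal{K}_2)=\sup_{f\in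 L(\mathcal{K}_1)}\inf_{g\in L(\mathcal{K}_2)}d(f,g)$; this is a genuine metric. The distance from a point to a subset is the infimum of the distances to its elements. *)

(* Defs.v *)
From HB Require Import structures.
From mathcomp Require Import all_boot all_order all_algebra.
From mathcomp Require Import all_classical all_reals all_analysis.

Set Implicit Arguments.
Unset Strict Implicit.
Unset Printing Implicit Defensive.

Import Order.TTheory GRing.Theory Num.Theory.
Import numFieldNormedType.Exports.

Local Open Scope classical_set_scope.
Local Open Scope ring_scope.

Definition nonempty_finite_subsets (S : Type) : set (set S) :=
  [set A | finite_set A /\ A !=set0].

Record simplicial_complex (S : Type) := SimplicialComplex {
  simplices : set (set S) ;
  simplices_neq0 : simplices !=set0 ;
  simplices_finite : simplices `<=` @nonempty_finite_subsets S ;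
  simplices_closed : forall A B : set S,
    simplices A -> B `<=` A -> B !=set0 -> simplices B }.

HB.instance Definition _ (S : Type) := gen_eqMixin (simplicial_complex S).
HB.instance Definition _ (S : Type) := gen_choiceMixin (simplicial_complex S).

Lemma simplicial_complexP (S : Type) (K1 K2 : simplicial_complex S) :
  simplices K1 = simplices K2 -> K1 = K2.
Proof.
case: K1 K2 => [K1 a1 b1 c1] [K2 a2 b2 c2] /= eK.
by subst K2; congr SimplicialComplex; exact: Prop_irrelevance.
Qed.

Lemma finite_nth (T : Type) (A : set T) : finite_set A -> A !=set0 ->
  exists (x : T) (s : seq T), A = nth x s @` `I_(size s).
Proof.
elim/Peq: T => T in A * => /finite_seqP[s ->] [x xs]; exists x, s.
apply/seteqP; split => y /=; first by move=> /(nthP x)[i ilt <-]; exists i.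
by move=> [i ilt <-]; exact: mem_nth.
Qed.

Section full_complex.
Variables (S : Type) (S0 : [set: S] !=set0).

Lemma full_neq0 : @nonempty_finite_subsets S !=set0.
Proof.
by have [s _] := S0; exists [set s]; split; [exact: finite_set1|exists s].
Qed.

Lemma full_closed (A B : set S) : nonempty_finite_subsets A ->
  B `<=` A -> B !=set0 -> nonempty_finite_subsets B.
Proof. by move=> [finA _] BA B0; split => //; exact: sub_finite_set finA. Qed.

(* If [S] is empty there is no simplicial complex over [S] at all. *)
Definition full_complex : simplicial_complex S :=
  SimplicialComplex full_neq0 (@subset_refl _ _) full_closed.

End full_complex.

Section measurable_maps.
Variables (R : realType) (S : Type).

Local Notation mu := (@lebesgue_measure R).

Definition Omega : set (measurableTypeR R) := `[0%R, 1%R]%classic.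

(* [S] carries the discrete sigma-algebra; the values outside [Omega] are
   irrelevant. Borel sets are used on [Omega]: a Lebesgue-measurable map with
   finitely many values almost everywhere is almost everywhere equal to a
   Borel one. *)
Record measurable_map := MeasurableMap {
  mmap_val :> measurableTypeR R -> S ;
  mmap_measurable : forall B : set S, measurable (Omega `&` mmap_val @^-1` B) }.

HB.instance Definition _ := gen_eqMixin measurable_map.
HB.instance Definition _ := gen_choiceMixin measurable_map.

Definition ae_equal (f g : measurable_map) : bool :=
  `[< (f : _ -> S) = g %[ae mu in Omega] >].

Lemma ae_equal_refl : reflexive ae_equal.
Proof. by move=> f; apply/asboolP; exact: aeW. Qed.

Lemma ae_equal_sym : symmetric ae_equal.
Proof.
by move=> f g; apply/asboolP/asboolP => /(@ae_eq_sym _ _ _ mu Omega).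
Qed.

Lemma ae_equal_trans : transitive ae_equal.
Proof.
move=> g f h /asboolP fg /asboolP gh; apply/asboolP.
exact: (@ae_eq_trans _ _ _ mu Omega _ _ g).
Qed.

Canonical ae_equal_equiv :=
  EquivRel ae_equal ae_equal_refl ae_equal_sym ae_equal_trans.

Local Open Scope quotient_scope.

Definition measurable_class : Type := {eq_quot ae_equal}.
HB.instance Definition _ := Choice.on measurable_class.
HB.instance Definition _ := EqQuotient.on measurable_class.

Definition class_fun (f : measurable_class) : measurableTypeR R -> S := repr f.
Coercion class_fun : measurable_class >-> Funclass.

Lemma class_fun_pi (f : measurable_map) :
  class_fun (\pi_measurable_class f) = f %[ae mu in Omega].
Proof.
apply/asboolP; rewrite -/(ae_equal _ _).
have /eqP := reprK (\pi_measurable_class f).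
by rewrite eqmodE.
Qed.

Lemma class_fun_measurable (f : measurable_class) (B : set S) :
  measurable (Omega `&` f @^-1` B).
Proof. exact: mmap_measurable. Qed.

(* Not the literal range of [f]: values taken on null sets are discarded. *)
Definition essential_image (f : measurableTypeR R -> S) : set S :=
  [set s | (0 < mu (Omega `&` f @^-1` [set s]))%E].

Definition L (K : simplicial_complex S) : set measurable_class :=
  [set f | simplices K (essential_image f) /\
           {ae mu, forall t, Omega t -> essential_image f (f t)}].

(* The library's [lebesgue_measure] is an outer measure on all sets of reals,
   so that this makes sense without measurability of the set. *)
Definition map_dist (f g : measurable_class) : R :=
  fine (mu (Omega `&` [set t | f t <> g t])).

Definition delta (K1 K2 : simplicial_complex S) : R :=
  sup [set inf [set map_dist f g | g in L K2] | f in L K1].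

Definition hausdorff_dist (K1 K2 : simplicial_complex S) : R :=
  Num.max (delta K1 K2) (delta K2 K1).

Lemma lebesgue_measure_le (A B : set (measurableTypeR R)) :
  A `<=` B -> (mu A <= mu B)%E.
Proof.
by move=> AB; exact: (@le_outer_measure R (ocitv_type R) (wlength idfun)^*%mu).
Qed.

Lemma lebesgue_measure_leU (A B : set (measurableTypeR R)) :
  (mu (A `|` B) <= mu A + mu B)%E.
Proof. exact: (@outer_measureU2 (ocitv_type R) R (wlength idfun)^*%mu A B). Qed.

Lemma measurable_Omega : measurable Omega.
Proof. exact: measurable_itv. Qed.

Lemma lebesgue_measure_Omega : mu Omega = 1%E.
Proof. by rewrite lebesgue_measure_itv/= lte_fin ltr01 sube0. Qed.

Lemma lebesgue_measure_Omega_fin A : mu (Omega `&` A) \is a fin_num.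
Proof.
rewrite ge0_fin_numE ?measure_ge0//.
apply: (@le_lt_trans _ _ (mu Omega)).
  by apply: lebesgue_measure_le => t [].
by rewrite lebesgue_measure_Omega ltry.
Qed.

Lemma map_dist_ge0 f g : 0 <= map_dist f g.
Proof. exact/fine_ge0/measure_ge0. Qed.

Lemma map_dist_le1 f g : map_dist f g <= 1.
Proof.
rewrite -[1]/(fine 1%E) /map_dist fine_le ?lebesgue_measure_Omega_fin//.
by rewrite -lebesgue_measure_Omega; by apply: lebesgue_measure_le => t [].
Qed.

Lemma map_distxx f : map_dist f f = 0.
Proof.
rewrite /map_dist (_ : _ `&` _ = set0) ?measure0//.
by apply/seteqP; split => // t [].
Qed.

Lemma map_dist_sym f g : map_dist f g = map_dist g f.
Proof.
congr (fine (mu (_ `&` _))).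
by apply/seteqP; split => t /= /[swap] ->.
Qed.

Lemma map_dist_triangle g f h : map_dist f h <= map_dist f g + map_dist g h.
Proof.
rewrite /map_dist -fineD ?lebesgue_measure_Omega_fin// fine_le//.
- exact: lebesgue_measure_Omega_fin.
- by rewrite fin_numD !lebesgue_measure_Omega_fin.
apply: le_trans (lebesgue_measure_leU _ _); apply: lebesgue_measure_le.
move=> t [Ot /= fh]; have [fg|fg] := pselect (f t = g t).
  by right; split => //=; rewrite -fg.
by left.
Qed.

Lemma measure_fiber_le (f g : measurableTypeR R -> S) (s : S) :
  (mu (Omega `&` f @^-1` [set s]) <=
   mu (Omega `&` g @^-1` [set s]) + mu (Omega `&` [set t | f t <> g t]))%E.
Proof.
apply: le_trans (lebesgue_measure_leU _ _); apply: lebesgue_measure_le.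
move=> t [Ot /= fs]; have [fg|fg] := pselect (f t = g t).
  by left; split => //=; rewrite -fg.
by right.
Qed.

Lemma essential_image_ae (f g : measurableTypeR R -> S) :
  f = g %[ae mu in Omega] -> essential_image f = essential_image g.
Proof.
suff sub (u v : measurableTypeR R -> S) : u = v %[ae mu in Omega] ->
    essential_image u `<=` essential_image v.
  move=> fg; apply/seteqP; split; apply: sub => //.
  by apply: filterS fg => t /[apply].
move=> [N [mN N0 uvN]] s /= us; rewrite /essential_image/=.
apply: (lt_le_trans us); apply: (le_trans (measure_fiber_le u v s)).
rewrite -[leRHS]adde0 leeD2l// -N0; apply: lebesgue_measure_le => t [Ot /= uv].
by apply: uvN => /= /(_ Ot).
Qed.

Lemma L_pi (K : simplicial_complex S) (f : measurable_map) :
  simplices K (essential_image f) ->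
  {ae mu, forall t, Omega t -> essential_image f (f t)} ->
  L K (\pi_measurable_class f).
Proof.
move=> Kf fae; have e := class_fun_pi f.
rewrite /L/= (essential_image_ae e); split => //.
by apply: filterS2 fae e => t + + Ot => /(_ Ot) + /(_ Ot) ->.
Qed.

Lemma measurable_map_exists (A : set S) : nonempty_finite_subsets A ->
  exists f : measurable_map, essential_image f = A /\
    {ae mu, forall t, Omega t -> essential_image f (f t)}.
Proof.
move=> [finA A0]; have [x [s AE]] := finite_nth finA A0; have [a Aa] := A0.
have s0 : (0 < size s)%N.
  by move: Aa; rewrite AE => -[i /= ilt _]; exact: leq_ltn_trans ilt.
have m0 : 0 < (size s)%:R :> R by rewrite ltr0n.
pose k (t : R) := Num.truncn (t * (size s)%:R).
pose f (t : measurableTypeR R) := if (k t < size s)%N then nth x s (k t) else a.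
have fA t : A (f t).
  by rewrite /f; case: ifPn => // kt; rewrite AE; exists (k t).
have kE (t : R) i : 0 <= t ->
    (k t = i) <-> i%:R / (size s)%:R <= t < i.+1%:R / (size s)%:R.
  move=> t0; rewrite ler_pdivrMr// ltr_pdivlMr// /k -truncn_eq ?mulr_ge0 ?ler0n//.
  by split => [->|/eqP].
have mk i : measurable (Omega `&` k @^-1` [set i]).
  have -> : Omega `&` k @^-1` [set i] = Omega `&`
      [set` `[i%:R / (size s)%:R, i.+1%:R / (size s)%:R[%R].
    apply/seteqP; split => t [Ot /= kt]; split => //=; rewrite ?in_itv/=.
      by apply/kE => //; move: Ot; rewrite /Omega/= in_itv/= => /andP[].
    by move: kt; rewrite in_itv/= => /kE; apply;
      move: Ot; rewrite /Omega/= in_itv/= => /andP[].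
  by apply: measurableI; exact: measurable_itv.
have mf (B : set S) : measurable (Omega `&` f @^-1` B).
  have -> : Omega `&` f @^-1` B = \bigcup_(i in
      [set i | B (if (i < size s)%N then nth x s i else a)])
      (Omega `&` k @^-1` [set i]).
    apply/seteqP; split => t; first by move=> [Ot Bt]; exists (k t).
    by move=> [i /= + [Ot kt]]; rewrite -kt; split.
  by apply: bigcup_measurable => i _; exact: mk.
have ess : essential_image f = A.
  apply/seteqP; split => [y|y Ay].
    rewrite /essential_image/=; apply: contraPP => Ay.
    rewrite (_ : _ `&` _ = set0) ?measure0 ?ltxx//.
    by apply/seteqP; split => // t [_ /= fty]; apply: Ay; rewrite -fty.
  move: Ay; rewrite {1}AE => -[i /= ism sy].
  have lti : i%:R / (size s)%:R < i.+1%:R / (size s)%:R :> R.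
    by rewrite ltr_pM2r ?invr_gt0// ltr_nat.
  rewrite /essential_image/=; apply: (@lt_le_trans _ _
    (mu [set` `[i%:R / (size s)%:R, i.+1%:R / (size s)%:R[%R])).
    by rewrite lebesgue_measure_itv/= lte_fin lti -EFinD lte_fin subr_gt0.
  apply: lebesgue_measure_le => t; rewrite /= in_itv/= => /[dup] it /andP[it1 it2].
  have t0 : 0 <= t by apply: le_trans it1; rewrite divr_ge0 ?ler0n.
  split => /=.
    rewrite /Omega/= in_itv/= t0/=; apply: (le_trans (ltW it2)).
    by rewrite ler_pdivrMr// mul1r ler_nat.
  by rewrite /f (iffRL (kE t i t0) it) ism.
exists (MeasurableMap mf); split => //=.
by apply: aeW => t _; rewrite ess.
Qed.

Lemma L_exists (K : simplicial_complex S) (A : set S) : simplices K A ->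
  exists2 f, L K f & essential_image f = A.
Proof.
move=> KA; have [f [fA fae]] := measurable_map_exists (simplices_finite KA).
exists (\pi_measurable_class f); first by apply: L_pi => //; rewrite fA.
by rewrite -fA; apply: essential_image_ae; exact: class_fun_pi.
Qed.

Lemma L_neq0 (K : simplicial_complex S) : L K !=set0.
Proof.
by have [A /L_exists[f Lf _]] := simplices_neq0 K; exists f.
Qed.

Definition L_dist (f : measurable_class) (K : simplicial_complex S) : R :=
  inf [set map_dist f g | g in L K].

Lemma has_inf_L_dist f K : has_inf [set map_dist f g | g in L K].
Proof.
split; first by have [g Kg] := L_neq0 K; exists (map_dist f g), g.
by exists 0 => _ [g _ <-]; exact: map_dist_ge0.
Qed.

Lemma L_dist_le f g K : L K g -> L_dist f K <= map_dist f g.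
Proof.
by move=> Kg; apply: ge_inf; [have [] := has_inf_L_dist f K|exists g].
Qed.

Lemma L_dist_ge0 f K : 0 <= L_dist f K.
Proof.
apply: lb_le_inf; first by have [] := has_inf_L_dist f K.
by move=> _ [g _ <-]; exact: map_dist_ge0.
Qed.

Lemma L_dist_le1 f K : L_dist f K <= 1.
Proof.
have [g Kg] := L_neq0 K.
by apply: le_trans (map_dist_le1 f g); exact: L_dist_le.
Qed.

Lemma L_dist_adherent f K (e : R) : 0 < e ->
  exists2 g, L K g & map_dist f g < L_dist f K + e.
Proof.
by move=> e0; have [_ [g Kg <-]] := inf_adherent e0 (has_inf_L_dist f K); exists g.
Qed.

Lemma has_sup_delta K1 K2 : has_sup [set L_dist f K2 | f in L K1].
Proof.
split; first by have [f Kf] := L_neq0 K1; exists (L_dist f K2), f.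
by exists 1 => _ [f _ <-]; exact: L_dist_le1.
Qed.

Lemma delta_ge f K1 K2 : L K1 f -> L_dist f K2 <= delta K1 K2.
Proof.
by move=> Kf; apply: ub_le_sup; [have [] := has_sup_delta K1 K2|exists f].
Qed.

Lemma delta_le K1 K2 (e : R) :
  (forall f, L K1 f -> L_dist f K2 <= e) -> delta K1 K2 <= e.
Proof.
move=> le; apply: ge_sup; first by have [] := has_sup_delta K1 K2.
by move=> _ [f /le ? <-].
Qed.

Lemma delta_ge0 K1 K2 : 0 <= delta K1 K2.
Proof.
have [f Kf] := L_neq0 K1.
by apply: le_trans (delta_ge K2 Kf); exact: L_dist_ge0.
Qed.

Lemma deltaxx K : delta K K = 0.
Proof.
apply/eqP; rewrite eq_le delta_ge0 andbT; apply: delta_le => f Kf.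
by rewrite -(map_distxx f); exact: L_dist_le.
Qed.

Lemma delta_triangle K2 K1 K3 : delta K1 K3 <= delta K1 K2 + delta K2 K3.
Proof.
apply: delta_le => f Kf; apply/ler_addgt0Pr => e e0.
have e20 : 0 < e / 2 by rewrite divr_gt0.
have [g Kg fg] := L_dist_adherent f K2 e20.
have [h Kh gh] := L_dist_adherent g K3 e20.
apply: (le_trans (L_dist_le f Kh)); apply: (le_trans (map_dist_triangle g f h)).
rewrite [e in leRHS]splitr addrACA; apply: lerD.
  by apply: (le_trans (ltW fg)); rewrite lerD2r; exact: delta_ge.
by apply: (le_trans (ltW gh)); rewrite lerD2r; exact: delta_ge.
Qed.

Lemma delta_eq0 K1 K2 : delta K1 K2 = 0 -> simplices K1 `<=` simplices K2.
Proof.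
move=> d0 A K1A; have [f Kf fA] := L_exists K1A.
have [finA A0] := simplices_finite K1A.
have [x [s AE]] := finite_nth finA A0.
pose w y := fine (mu (Omega `&` f @^-1` [set y])).
have wE y : (w y)%:E = mu (Omega `&` f @^-1` [set y]).
  by rewrite fineK// lebesgue_measure_Omega_fin.
have w0 y : A y -> 0 < w y by rewrite -fA /essential_image/= -wE lte_fin.
have [e e0 ew] : exists2 e, 0 < e & forall y, A y -> e <= w y.
  exists (\big[Num.min/1]_(i < size s) w (nth x s i)).
    apply: lt_bigmin => // i _; apply: w0; rewrite AE; exists i => //=.
  rewrite AE => _ [i /= ilt <-].
  exact: (bigmin_le_cond _ (fun i : 'I_(size s) => w (nth x s i)) (j := Ordinal ilt)).
have [g Kg fg] := L_dist_adherent f K2 e0.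
have dfg : map_dist f g < e.
  apply: (lt_le_trans fg); rewrite gerDr -d0; exact: delta_ge.
apply: (simplices_closed Kg.1) => // y Ay; rewrite /essential_image/=.
rewrite lt_neqAle measure_ge0 andbT eq_sym; apply/eqP => gy0.
have := measure_fiber_le f g y; rewrite gy0 add0e -wE.
have -> : mu (Omega `&` [set t | f t <> g t]) = (map_dist f g)%:E.
  by rewrite fineK// lebesgue_measure_Omega_fin.
by rewrite lee_fin leNgt (lt_le_trans dfg)// ew.
Qed.

Lemma hausdorff_distxx K : hausdorff_dist K K = 0.
Proof. by rewrite /hausdorff_dist deltaxx maxxx. Qed.

Lemma hausdorff_dist_sym K1 K2 : hausdorff_dist K1 K2 = hausdorff_dist K2 K1.
Proof. exact: maxC. Qed.

Lemma hausdorff_dist_triangle K2 K1 K3 :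
  hausdorff_dist K1 K3 <= hausdorff_dist K1 K2 + hausdorff_dist K2 K3.
Proof.
rewrite ge_max; apply/andP; split.
  by apply: (le_trans (delta_triangle K2 _ _)); apply: lerD; rewrite le_max lexx.
apply: (le_trans (delta_triangle K2 _ _)); rewrite addrC.
by apply: lerD; rewrite le_max lexx orbT.
Qed.

Lemma hausdorff_dist_eq0 K1 K2 : hausdorff_dist K1 K2 = 0 -> K1 = K2.
Proof.
move=> d0.
have [d12 d21] : delta K1 K2 = 0 /\ delta K2 K1 = 0.
  split; apply/eqP; rewrite eq_le delta_ge0 andbT -d0 le_max lexx ?orbT//.
by apply/simplicial_complexP/seteqP; split; exact: delta_eq0.
Qed.

End measurable_maps.

(* The phantom parameter [R] is the type in which distances take their values. *)
Definition complexes (R : realType) (S : Type) : Type := simplicial_complex S.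

HB.instance Definition _ (R : realType) (S : Type) :=
  Choice.on (complexes R S).
HB.instance Definition _ (R : realType) (S : Type) :=
  @isMetric.Build R (complexes R S) (@hausdorff_dist R S)
    (@hausdorff_distxx R S) (@hausdorff_dist_eq0 R S)
    (@hausdorff_dist_sym R S) (@hausdorff_dist_triangle R S).

Definition complexes_dim (R : realType) (S : Type) (n : nat) :
    set (complexes R S) :=
  [set K | forall A, simplices K A -> (A #<= `I_n.+1)%card].
Arguments complexes_dim : clear implicits.

Definition complexes_fin_dim (R : realType) (S : Type) : set (complexes R S) :=
  \bigcup_n complexes_dim R S n.
Arguments complexes_fin_dim : clear implicits.

Definition dist_to_set (R : realType) (T : metricType R) (x : T) (A : set T) : R :=
  inf [set mdist x y | y in A].

(* Main.v *)
Require Import Defs.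
From mathcomp Require Import all_boot all_order all_algebra.
From mathcomp Require Import all_classical all_reals all_analysis.

Set Implicit Arguments.
Unset Strict Implicit.
Unset Printing Implicit Defensive.

Import Order.TTheory GRing.Theory Num.Theory.

Local Open Scope classical_set_scope.
Local Open Scope ring_scope.

(** Everything rests on maps that are as evenly spread as possible. If [A] has
    [N] elements, cutting [[0, 1]] into [N] intervals of equal length gives a
    map whose essential image is [A] and all of whose fibers have measure
    [1 / N] (lemma [uniform_L]). It is far from a complex [K2] for two reasons.

    - If [A] is not a simplex of [K2], a map closer than [1 / N] would still
      take every value of [A] on a set of positive measure, so its essential
      image would contain [A], which is impossible in [K2] (lemma
      [delta_ge_missing]).
    - If the simplices of [K2] have at most [n] elements, a map into [K2] agrees
      with it on at most [n] fibers, so the distance is at least [1 - n / N]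
      (lemma [delta_ge_dim]).

    The first bound isolates a complex [K] whose simplices have at most [n]
    elements: another complex [K'] either lacks a simplex of [K], or has a
    simplex outside [K], which can be taken with at most [n + 1] elements since
    every subset of [n + 1] elements of a larger simplex is again a simplex of
    [K'] outside [K]. Hence [d(K, K') >= 1 / (n + 1)] (lemma
    [hausdorff_dist_ge]), so that each point of [S_n] is isolated in the whole
    space. The second bound, with [N] going to infinity, puts the full complex
    at distance exactly [1] from every complex of finite dimension.

    Conversely let [K] have a simplex [A] with [N >= 2] elements, and let [K']
    be the complex of those simplices of [K] that do not contain [A]. Given a
    map [f] into [K] whose essential image contains [A], one of the [N] disjoint
    fibers over [A] has measure at most [1 / N]; redirecting it to another
    element of [A] moves [f] into [K']. So [K'] differs from [K] and
    [d(K, K') <= 1 / N] (lemma [exists_near_complex]); if [K] has simplices of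
    arbitrarily large cardinality, then it is not isolated. *)

(** * Finite sets listed by integers *)

Lemma card_eq_enum (T : Type) (A : set T) (m : nat) :
  A !=set0 -> (A #= `I_m)%card ->
  exists2 e : nat -> T, A = e @` `I_m & {in `I_m &, injective e}.
Proof.
move=> [a Aa] /card_set_bijP[f [fA finj fsurj]].
have /choice[e eP] i : exists x, `I_m i -> A x /\ f x = i.
  have [im|im] := pselect (`I_m i); first by have [x Ax fx] := fsurj _ im; exists x.
  by exists a.
exists e => [|i j /set_mem im /set_mem jm eij].
  apply/seteqP; split => [x Ax|_ [i im <-]]; last by have [] := eP _ im.
  exists (f x); first exact: fA.
  have [Ae fe] := eP _ (fA _ Ax); apply: finj => //; exact: mem_set.
by have [_ <-] := eP _ im; have [_ <-] := eP _ jm; rewrite eij.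
Qed.

Lemma card_eq_neq0 (T : Type) (A : set T) (N : nat) :
  (A #= `I_N)%card -> A !=set0 <-> (0 < N)%N.
Proof.
move=> AN; split => [A0|N0].
  by have [e AE _] := card_eq_enum A0 AN; have [a] := A0;
    rewrite AE => -[i /= /(leq_ltn_trans _)->].
apply/set0P/negP => /eqP A0; move: AN; rewrite A0 card_eq_sym card_eq0.
by move=> /eqP/seteqP[/(_ 0%N) /(_ N0)].
Qed.

Lemma card_gt1_other (T : Type) (A : set T) (N : nat) (a : T) :
  A !=set0 -> (A #= `I_N)%card -> (1 < N)%N -> exists2 b, A b & b <> a.
Proof.
move=> A0 AN N1; have [e -> einj] := card_eq_enum A0 AN.
have [e0a|e0a] := pselect (e 0%N = a); last first.
  by exists (e 0%N) => //; exists 0%N => //=; exact: ltnW.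
exists (e 1%N); first by exists 1%N.
rewrite -e0a => /einj; rewrite !inE => e10; suff: 1%N = 0%N by [].
by apply: e10 => //=; exact: ltnW.
Qed.

(** * Equal subdivisions of the unit interval *)

Section hausdorff_estimates.
Variable R : realType.
Local Notation mu := (@lebesgue_measure R).
Local Notation Om := (@Omega R).

(** The index of the interval of the subdivision that contains [t]. On [[0, 1]]
    the minimum only matters at [t = 1], which joins the last interval. *)
Definition cell (N : nat) (t : measurableTypeR R) : nat :=
  minn (Num.truncn (t * N%:R)) N.-1.

Lemma cell_lt (N : nat) t : (0 < N)%N -> (cell N t < N)%N.
Proof. by move=> N0; rewrite -{2}(prednK N0) ltnS geq_minr. Qed.

Lemma sub_cell_fiber (N i : nat) : (i < N)%N ->
  [set` `[i%:R / N%:R, i.+1%:R / N%:R[%R] `<=` Om `&` cell N @^-1` [set i].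
Proof.
move=> iN t; rewrite /= in_itv/=.
have N0 : 0 < N%:R :> R by rewrite ltr0n (leq_ltn_trans _ iN).
rewrite ler_pdivrMr// ltr_pdivlMr// => /andP[it ti]; have t0 : 0 <= t.
  by rewrite -(pmulr_lge0 _ N0) (le_trans _ it).
split.
  rewrite /Omega/= in_itv/= t0/= -(ler_pM2r N0) mul1r (le_trans (ltW ti))//.
  by rewrite ler_nat.
rewrite /= /cell (_ : Num.truncn _ = i).
  by apply/minn_idPl; rewrite -ltnS (ltn_predK iN).
by apply/eqP; rewrite truncn_eq ?mulr_ge0 ?ler0n ?it.
Qed.

Lemma cell_fiber_sub (N i : nat) : (i < N)%N ->
  Om `&` cell N @^-1` [set i] `<=` [set` `[i%:R / N%:R, i.+1%:R / N%:R]%R].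
Proof.
move=> iN t [+ <-]; rewrite /Omega/= !in_itv/= => /andP[t0 t1].
have N0 : 0 < N%:R :> R by rewrite ltr0n (leq_ltn_trans _ iN).
have tN : 0 <= t * N%:R by rewrite mulr_ge0// ltW.
have := truncn_itv tN; rewrite /cell; set k := Num.truncn _ => /andP[kt tk].
rewrite ler_pdivrMr// ler_pdivlMr//; apply/andP; split.
  by apply: le_trans kt; rewrite ler_nat geq_minl.
have [kN|Nk] := leqP k N.-1; first by rewrite ltW.
by rewrite (ltn_predK iN) ler_piMl// ltW.
Qed.

(** The previous two inclusions determine the fiber up to one endpoint. *)
Lemma measurable_cell (N i : nat) : (i < N)%N ->
  measurable (Om `&` cell N @^-1` [set i]).
Proof.
move=> iN; have lo := sub_cell_fiber iN; have up := cell_fiber_sub iN.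
set F := Om `&` _ in lo up *; set p := i.+1%:R / N%:R in lo up.
have -> : F = [set` `[i%:R / N%:R, p[%R] `|` (F `&` [set p]).
  apply/seteqP; split => t; last by case=> [/lo//|[]].
  move=> Ft; have := up _ Ft; rewrite /= !in_itv/= => /andP[-> +].
  by rewrite le_eqVlt => /orP[/eqP tp|->]; [right|left].
apply: measurableU; first exact: measurable_itv.
apply: countable_measurable => [t|]; first exact: measurable_set1.
exact/finite_set_countable/(sub_finite_set (@subIsetr _ _ _))/finite_set1.
Qed.

Lemma lebesgue_measure_cell (N i : nat) : (i < N)%N ->
  mu (Om `&` cell N @^-1` [set i]) = (N%:R^-1)%:E.
Proof.
move=> iN.
have lti : i%:R / N%:R < i.+1%:R / N%:R :> R.
  by rewrite ltr_pM2r ?ltr_nat// invr_gt0 ltr0n (leq_ltn_trans _ iN).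
have len : ((i.+1%:R / N%:R)%:E - (i%:R / N%:R)%:E = (N%:R^-1)%:E :> \bar R)%E.
  by rewrite -EFinB -mulrBl -natrB// subSnn mul1r.
apply/eqP; rewrite eq_le; apply/andP; split.
  apply: le_trans (lebesgue_measure_le (cell_fiber_sub iN)) _.
  by rewrite lebesgue_measure_itv/= lte_fin lti len.
apply: le_trans (lebesgue_measure_le (sub_cell_fiber iN)).
by rewrite lebesgue_measure_itv/= lte_fin lti len.
Qed.

(** * Maps with equal fibers *)

Variable S : Type.
Implicit Types (f g : measurable_class R S) (A : set S).
Implicit Types (K : simplicial_complex S).
Local Notation fiber f s := (Om `&` f @^-1` [set s]).

Lemma ae_eq_measure0 (f g : measurableTypeR R -> S) : f = g %[ae mu in Om] ->
  mu (Om `&` [set t | f t <> g t]) = 0%E.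
Proof.
move=> [M [mM M0 fgM]]; apply/eqP; rewrite eq_le measure_ge0 andbT -M0.
by apply: lebesgue_measure_le => t [Ot /= fg]; apply: fgM => /= /(_ Ot).
Qed.

Lemma measure_fiber_ae (f g : measurableTypeR R -> S) (s : S) :
  f = g %[ae mu in Om] -> mu (fiber f s) = mu (fiber g s).
Proof.
move=> fg; apply/eqP; rewrite eq_le; apply/andP; split.
  by rewrite -[leRHS]adde0 -(ae_eq_measure0 fg) measure_fiber_le.
rewrite -[leRHS]adde0 -(ae_eq_measure0 (ae_eq_sym fg)); exact: measure_fiber_le.
Qed.

(** The test maps for the lower bounds of the distance: a listing of [A]
    composed with [cell N]. *)
Lemma uniform_L K A N : simplices K A -> (A #= `I_N)%card ->
  exists f : measurable_class R S, [/\ L K f, essential_image f = A &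
    forall s, A s -> mu (fiber f s) = (N%:R^-1)%:E].
Proof.
move=> KA AN; have [finA A0] := simplices_finite KA.
have [e AE einj] := card_eq_enum A0 AN.
have N0 : (0 < N)%N by apply/(card_eq_neq0 AN).
pose f (t : measurableTypeR R) := e (cell N t).
have fA t : A (f t) by rewrite AE; exists (cell N t) => //; exact: cell_lt.
have fiberE i : (i < N)%N -> fiber f (e i) = Om `&` cell N @^-1` [set i].
  move=> iN; apply/seteqP; split => t [Ot ft]; split => //=; last by rewrite /f ft.
  by apply: einj => //; apply/mem_set => //=; exact: cell_lt.
have mf (B : set S) : measurable (Om `&` f @^-1` B).
  rewrite (_ : _ `&` _ = \bigcup_(i in [set i | (i < N)%N /\ B (e i)])
      (Om `&` cell N @^-1` [set i])); last first.
    apply/seteqP; split => t; last by move=> [i [_ Bi] [Ot ti]]; rewrite /f/= ti.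
    by move=> [Ot Bt]; exists (cell N t) => //; split => //; exact: cell_lt.
  by apply: bigcup_measurable => i [iN _]; exact: measurable_cell.
have wf s : A s -> mu (fiber f s) = (N%:R^-1)%:E.
  by rewrite AE => -[i /= iN <-]; rewrite fiberE// lebesgue_measure_cell.
have ess : essential_image f = A.
  apply/seteqP; split => [s|s As]; rewrite /essential_image/=; last first.
    by rewrite wf// lte_fin invr_gt0 ltr0n.
  apply: contraPP => As; rewrite (_ : fiber f s = set0) ?measure0 ?ltxx//.
  by apply/seteqP; split => // t [_ /= fts]; apply: As; rewrite -fts.
have fae := class_fun_pi (MeasurableMap mf).
exists (\pi_(measurable_class R S) (MeasurableMap mf))%qT; split.
- by apply: L_pi => /=; rewrite ess//; exact: aeW.
- by rewrite (essential_image_ae fae).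
- by move=> s As; rewrite (measure_fiber_ae _ fae) wf.
Qed.

(** * Lower bounds of the distance *)

Lemma delta_ge_map K1 K2 f (c : R) : L K1 f ->
  (forall g, L K2 g -> c <= map_dist f g) -> c <= delta R K1 K2.
Proof.
move=> Kf cf; apply: le_trans (delta_ge K2 Kf); apply: lb_le_inf.
  by have [] := has_inf_L_dist f K2.
by move=> _ [g Kg <-]; exact: cf.
Qed.

Lemma map_distE f g :
  mu (Om `&` [set t | f t <> g t]) = (map_dist f g)%:E.
Proof. by rewrite fineK// lebesgue_measure_Omega_fin. Qed.

(** A map at distance less than [1 / N] from a uniform map on [A] cannot lose a
    value of [A], since it would have to differ on a whole fiber. *)
Lemma delta_ge_missing K1 K2 A N : simplices K1 A -> ~ simplices K2 A ->
  (A #= `I_N)%card -> N%:R^-1 <= delta R K1 K2.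
Proof.
move=> K1A K2A AN; have [f [Kf fA wf]] := uniform_L K1A AN.
apply: (delta_ge_map Kf) => g Kg; rewrite leNgt; apply/negP => dN; apply: K2A.
have [_ A0] := simplices_finite K1A.
apply: (simplices_closed Kg.1) => // s As; rewrite /essential_image/=.
rewrite lt_neqAle measure_ge0 andbT eq_sym; apply/eqP => gs0.
have := measure_fiber_le f g s.
by rewrite gs0 add0e wf// map_distE lee_fin leNgt dN.
Qed.

(** A map with at most [n] values can only agree with a uniform map on [A] on
    [n] of its fibers, that is, on a set of measure at most [n / N]. *)
Lemma delta_ge_dim K1 K2 A N n : simplices K1 A -> (A #= `I_N)%card ->
  (forall B, simplices K2 B -> (B #<= `I_n)%card) ->
  1 - n%:R / N%:R <= delta R K1 K2.
Proof.
move=> K1A AN K2n; have [f [Kf fA wf]] := uniform_L K1A AN.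
have {}wf s : (mu (fiber f s) <= (N%:R^-1)%:E)%E.
  have [/wf->//|nAs] := pselect (A s).
  apply: (@le_trans _ _ 0%E); last by rewrite lee_fin invr_ge0.
  by rewrite leNgt; apply/negP; move: nAs; rewrite -fA.
apply: (delta_ge_map Kf) => g [K2g gae].
have [/finite_setP[k gk] g0] := simplices_finite K2g.
have kn : (k <= n)%N by rewrite -card_le_II -(card_le_eql gk) K2n.
have [e gE _] := card_eq_enum g0 gk.
have null : mu (Om `&` [set t | ~ essential_image g (g t)]) = 0%E.
  have [M [mM M0 gM]] := gae; apply/eqP; rewrite eq_le measure_ge0 andbT -M0.
  by apply: lebesgue_measure_le => t [Ot /= gt]; apply: gM => /= /(_ Ot).
have fibers : (mu (\big[setU/set0]_(i < k) fiber f (e i)) <= (k%:R / N%:R)%:E)%E.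
  have mfib i : (i < k)%N -> measurable (fiber f (e i)).
    by move=> _; exact: class_fun_measurable.
  apply: (le_trans (Boole_inequality mu mfib)).
  apply: (@le_trans _ _ (\sum_(i < k) (N%:R^-1)%:E)%E).
    by apply: lee_sum => i _; exact: wf.
  by rewrite sumEFin sumr_const card_ord mulr_natl.
set F := \big[setU/set0]_(i < k) _ in fibers.
set D := Om `&` [set t | f t <> g t].
set Z := Om `&` _ in null.
have cover : (mu Om <= mu D + (mu F + mu Z))%E.
  apply: le_trans (leeD2l (mu D) (lebesgue_measure_leU F Z)).
  apply: le_trans (lebesgue_measure_leU D _); apply: lebesgue_measure_le => t Ot.
  have [fg|] := pselect (f t = g t); last by left.
  have [|] := pselect (essential_image g (g t)); last by right; right.
  rewrite {1}gE => -[i ik ei]; right; left.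
  rewrite /F -(bigcup_mkord k (fun i => fiber f (e i))).
  by exists i => //; split => //=; rewrite ei.
rewrite lerBlDr -lee_fin -lebesgue_measure_Omega EFinD -map_distE.
apply: (le_trans cover); rewrite leeD2l// null adde0 (le_trans fibers)// lee_fin.
by rewrite ler_wpM2r ?invr_ge0 ?ler_nat.
Qed.

(** * Redirecting a small fiber *)

Lemma delta_sub K1 K2 : simplices K1 `<=` simplices K2 -> delta R K1 K2 = 0.
Proof.
move=> K12; apply/eqP; rewrite eq_le delta_ge0 andbT; apply: delta_le => f [Kf fae].
by rewrite -(map_distxx f); apply: L_dist_le; split => //; exact: K12.
Qed.

(** The fibers over the [N] elements of [A] are disjoint in a space of
    measure [1]. *)
Lemma exists_light_fiber f A N : A !=set0 -> (A #= `I_N)%card ->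
  exists2 a, A a & (mu (fiber f a) <= (N%:R^-1)%:E)%E.
Proof.
move=> A0 AN; have [e AE einj] := card_eq_enum A0 AN.
have N0 : (0 < N)%N by apply/(card_eq_neq0 AN).
apply: contrapT => heavy.
have {}heavy i : (i < N)%N -> N%:R^-1 < fine (mu (fiber f (e i))).
  move=> iN; rewrite -lte_fin fineK ?lebesgue_measure_Omega_fin// ltNge.
  by apply/negP => le; apply: heavy; exists (e i) => //; rewrite AE; exists i.
have triv : trivIset `I_N (fun i => fiber f (e i)).
  move=> i j iN jN [t [[_ ti] [_ tj]]]; apply: einj; rewrite ?inE//.
  by rewrite -ti -tj.
have := measure_fin_bigcup mu (finite_II N) triv
  (fun i _ => class_fun_measurable f [set e i]).
rewrite -fsbig_ord /= => sumE.
have : (mu (\bigcup_(i in `I_N) fiber f (e i)) <= 1)%E.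
  rewrite -lebesgue_measure_Omega; apply: lebesgue_measure_le.
  by move=> t [i _ []].
rewrite [leLHS]sumE; under eq_bigr => i _.
  rewrite -[mu _]fineK ?lebesgue_measure_Omega_fin//; over.
rewrite sumEFin lee_fin leNgt => /negP; apply.
have -> : 1 = \sum_(i < N) N%:R^-1 :> R.
  by rewrite sumr_const card_ord -[RHS]mulr_natl mulfV// pnatr_eq0 -lt0n.
apply: ltr_sum => [|i _]; last exact: heavy.
by apply/hasP; exists (Ordinal N0); rewrite ?mem_index_enum.
Qed.

(** Sending the fiber of [f] over [a] to [b] removes [a] from the essential
    image; as [b] is already a value of [f], no new value appears. *)
Lemma collapse_map f (a b : S) : b <> a -> essential_image f b ->
  {ae mu, forall t, Om t -> essential_image f (f t)} ->
  exists g : measurable_class R S,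
    [/\ essential_image g = essential_image f `\ a,
        {ae mu, forall t, Om t -> essential_image g (g t)} &
        ((map_dist f g)%:E <= mu (fiber f a))%E].
Proof.
move=> ba fb fae; pose h s := if `[< s = a >] then b else s.
have hN s : s <> a -> h s = s by move=> sa; rewrite /h asboolF.
have ha : h a = b by rewrite /h asboolT.
have mh (B : set S) : measurable (Om `&` (h \o f) @^-1` B).
  exact: (class_fun_measurable f (h @^-1` B)).
have sub s : s <> a -> (mu (fiber f s) <= mu (fiber (h \o f) s))%E.
  move=> sa; apply: lebesgue_measure_le => t [Ot /= fs]; split => //=.
  by rewrite fs hN.
have ess : essential_image (h \o f) = essential_image f `\ a.
  apply/seteqP; split => s; rewrite /essential_image/=; last first.
    by move=> [fs sa]; exact: lt_le_trans (sub _ sa).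
  have [->|sa] := pselect (s = a).
    rewrite (_ : fiber _ _ = set0) ?measure0 ?ltxx//; apply/seteqP; split => // t.
    rewrite /= => -[_]; have [->|fta] := pselect (f t = a); first by rewrite ha.
    by rewrite hN.
  move=> hs; split => //; have [->//|sb] := pselect (s = b).
  apply: (lt_le_trans hs); apply: lebesgue_measure_le => t [Ot /=].
  have [->|fta] := pselect (f t = a); first by rewrite ha => /esym.
  by rewrite hN.
have gae := class_fun_pi (MeasurableMap mh).
exists (\pi_(measurable_class R S) (MeasurableMap mh))%qT.
rewrite (essential_image_ae gae) ess; split => //.
  apply: filterS2 fae gae => t + + Ot => /(_ Ot) ft /(_ Ot) -> /=.
  have [->|fta] := pselect (f t = a); first by rewrite ha.
  by rewrite hN.
rewrite -map_distE -[leRHS]adde0 -(ae_eq_measure0 (ae_eq_sym gae)).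
apply: le_trans (lebesgue_measure_leU _ _); apply: lebesgue_measure_le.
move=> t [Ot /= fg]; have [fta|fta] := pselect (f t = a); first by left.
by right; split => //=; rewrite hN.
Qed.

(** Only the maps whose essential image contains [A] have to be moved. For them
    the element [b] of [A] that replaces the light value [a] is a value of [f],
    so that the new image is a subset of a simplex of [K]. *)
Lemma delta_avoid_le K K' A N : simplices K A -> (A #= `I_N)%card ->
  (1 < N)%N -> simplices K' = [set B | simplices K B /\ ~ A `<=` B] ->
  delta R K K' <= N%:R^-1.
Proof.
move=> KA AN N1 K'E; have [finA A0] := simplices_finite KA.
apply: delta_le => f [Kf fae]; have [Af|nAf] := pselect (A `<=` essential_image f).
  have [a Aa fa] := exists_light_fiber f A0 AN.
  have [b Ab ba] := card_gt1_other a A0 AN N1.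
  have [g [gE gae dfg]] := collapse_map ba (Af _ Ab) fae.
  have K'g : L K' g.
    split => //; rewrite K'E gE; split => [|/(_ a Aa)[_ /=]//].
    by apply: simplices_closed Kf _ _ => [s []//|]; exists b; split; [exact: Af|].
  by apply: (le_trans (L_dist_le f K'g)); rewrite -lee_fin (le_trans dfg).
apply: (@le_trans _ _ 0); last by rewrite invr_ge0.
by rewrite -(map_distxx f); apply: L_dist_le; split => //; rewrite K'E.
Qed.

(** The complex [K'] consists of the simplices of [K] that do not contain [A].
    It is not empty because [A], having two elements, is not contained in a
    singleton. *)
Lemma exists_near_complex K A N : simplices K A -> (A #= `I_N)%card ->
  (1 < N)%N ->
  exists2 K', K' <> K & hausdorff_dist R K K' <= N%:R^-1.
Proof.
move=> KA AN N1; have [finA A0] := simplices_finite KA.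
have sneq0 : [set B | simplices K B /\ ~ A `<=` B] !=set0.
  have [a Aa] := A0; have [b Ab ba] := card_gt1_other a A0 AN N1.
  exists [set a]; split => [|/(_ b Ab)//].
  by apply: (simplices_closed KA); [move=> _ ->|exists a].
have sfin : [set B | simplices K B /\ ~ A `<=` B] `<=` @nonempty_finite_subsets S.
  by move=> B [/simplices_finite].
have sclosed (B C : set S) : simplices K B /\ ~ A `<=` B -> C `<=` B ->
    C !=set0 -> simplices K C /\ ~ A `<=` C.
  move=> [KB nAB] CB C0; split; first exact: simplices_closed KB CB C0.
  by move=> AC; apply: nAB; exact: subset_trans CB.
pose K' := SimplicialComplex sneq0 sfin sclosed.
exists K'; first by move=> K'K; move: KA; rewrite -K'K => -[_ []].
rewrite ge_max (delta_avoid_le KA AN N1)//= delta_sub ?invr_ge0//.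
by move=> B [].
Qed.

(** * Isolation of finite-dimensional complexes *)

(** The bound does not depend on [K']: a simplex of [K'] outside [K] can be cut
    down to [n + 1] elements, which is already too many for [K]. *)
Lemma hausdorff_dist_ge K K' n : (forall A, simplices K A -> (A #<= `I_n)%card) ->
  K' <> K -> n.+1%:R^-1 <= hausdorff_dist R K K'.
Proof.
move=> Kn K'K.
have small K1 K2 A m : simplices K1 A -> ~ simplices K2 A -> (A #= `I_m)%card ->
    (m <= n.+1)%N -> n.+1%:R^-1 <= delta R K1 K2.
  move=> K1A K2A Am mn; apply: le_trans (delta_ge_missing K1A K2A Am).
  have m0 : (0 < m)%N by apply/(card_eq_neq0 Am); have [] := simplices_finite K1A.
  by rewrite lef_pV2 ?posrE ?ltr0n// ler_nat.
rewrite le_max; apply/orP; have [KK'|] := pselect (simplices K `<=` simplices K').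
  right; have /existsNP[A /not_implyP[K'A KA]] : ~ simplices K' `<=` simplices K.
    by move=> K'_K; apply: K'K; apply/simplicial_complexP/seteqP.
  have [/finite_setP[k Ak] A0] := simplices_finite K'A.
  have [kn|nk] := leqP k n.+1; first exact: (small _ _ _ _ K'A KA Ak kn).
  have /card_subP[B Bn BA] : (`I_n.+1 #<= A)%card.
    by rewrite (card_le_eqr Ak) card_le_II ltnW.
  have nKB : ~ simplices K B.
    by move=> /Kn; rewrite (card_le_eql Bn) card_le_II ltnn.
  apply: (small _ _ _ _ _ nKB Bn (leqnn _)); apply: (simplices_closed K'A BA).
  exact/(card_eq_neq0 Bn).
move=> /existsNP[A /not_implyP[KA K'A]]; left.
have [/finite_setP[k Ak] _] := simplices_finite KA.
apply: (small _ _ _ _ KA K'A Ak); apply: ltnW.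
by rewrite ltnS -card_le_II -(card_le_eql Ak) Kn.
Qed.

End hausdorff_estimates.

(** * The topology of the space of complexes *)

Section topology.
Variables (R : realType) (S : Type).
Implicit Types K : complexes R S.

Lemma nbhs_complex_dim n K : complexes_dim R S n K -> nbhs K [set K].
Proof.
move=> Kn; have n0 : 0 < n.+2%:R^-1 :> R by rewrite invr_gt0.
apply/nbhs_ballP; exists n.+2%:R^-1 => //=; rewrite ballEmdist => K' /= KK'.
by apply: contrapT => /(hausdorff_dist_ge R Kn); rewrite leNgt KK'.
Qed.

(** Otherwise [K] has a simplex with so many elements that the complex given by
    [exists_near_complex] lies in the given neighbourhood. *)
Lemma fin_dim_of_nbhs K : nbhs K [set K] -> complexes_fin_dim R S K.
Proof.
move=> /nbhs_ballP[r /= r0]; rewrite ballEmdist => ballK; apply: contrapT => Kinf.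
have [n nr] : exists n : nat, n.+1%:R^-1 < r.
  exists (Num.truncn r^-1); rewrite invf_plt ?posrE//; exact: truncnS_gt.
apply: Kinf; exists n => // A KA; apply: contrapT => nA.
have [/finite_setP[k Ak] _] := simplices_finite KA.
have nk : (n.+1 < k)%N.
  rewrite ltnNge; apply/negP => kn; apply: nA.
  by rewrite (card_le_eql Ak) card_le_II.
have k1 : (1 < k)%N by apply: leq_trans nk.
have [K' K'K KK'] := exists_near_complex R KA Ak k1.
apply: K'K; apply: ballK => /=; apply: (le_lt_trans KK'); apply: le_lt_trans nr.
by rewrite lef_pV2 ?posrE ?ltr0n ?(ltnW k1)// ler_nat ltnW.
Qed.

Lemma open_complexes_dim n (U : set (complexes_dim R S n)) : open U.
Proof.
(* each point of [U] is isolated in the whole space, so [U] is open there *)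
exists (set_val @` U); last first.
  by apply/seteqP; split => [x [y Uy /val_inj <-]//|x Ux]; exists x.
rewrite openE => _ [K UK <-]; rewrite /interior.
have Kn : complexes_dim R S n (set_val K) by exact: set_valP.
by have := nbhs_complex_dim Kn; apply: filterS => _ ->; exists K.
Qed.

(** The full complex contains uniform maps with arbitrarily many values, and
    [1 - (n + 1) / N] tends to [1]. *)
Lemma mdist_full_fin_dim (Sinf : infinite_set [set: S]) K :
  complexes_fin_dim R S K ->
  mdist (full_complex (infinite_setN0 Sinf) : complexes R S) K = 1.
Proof.
set P : complexes R S := full_complex _; move=> [n _ Kn].
apply/eqP; rewrite eq_le; apply/andP; split.
  by rewrite ge_max !delta_le// => f _; exact: L_dist_le1.
rewrite le_max; apply/orP; left; apply/ler_addgt0Pr => r r0.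
(* chosen so that [n.+1 / N < r] *)
pose N := (Num.truncn (n.+1%:R / r)).+1.
have /card_subP[A AN _] : (`I_N #<= [set: S])%card.
  apply: (@card_le_trans _ _ _ [set: nat]); first exact: subset_card_le.
  exact/infiniteP.
have PA : simplices P A.
  by split; [apply/finite_setP; exists N|exact/(card_eq_neq0 AN)].
rewrite -lerBlDr; apply: le_trans (delta_ge_dim R PA AN Kn); rewrite lerB//.
by rewrite ler_pdivrMr ?ltr0n// mulrC -ler_pdivrMr// ltW// truncnS_gt.
Qed.

(** Witnessed by the complex of a single vertex. *)
Lemma complexes_fin_dim_neq0 : [set: S] !=set0 -> complexes_fin_dim R S !=set0.
Proof.
move=> [x _].
have sneq0 : [set [set x]] !=set0 by exists [set x].
have sfin : [set [set x]] `<=` @nonempty_finite_subsets S.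
  by move=> _ ->; split; [exact: finite_set1|exists x].
have sclosed (A B : set S) : [set [set x]] A -> B `<=` A -> B !=set0 ->
    [set [set x]] B.
  move=> -> Bx B0; apply/seteqP; split => // _ ->.
  by have [y By] := B0; rewrite -(Bx _ By).
exists (SimplicialComplex sneq0 sfin sclosed), 0%N => // _ ->.
by rewrite (card_le_eql card_set1) card_le_II.
Qed.

End topology.

Theorem proposition3p1 (R : realType) (S : Type) :
  [/\ forall (n : nat) (U : set (complexes_dim R S n)), open U,
      forall Sinf : infinite_set [set: S],
        let P : complexes R S := full_complex (infinite_setN0 Sinf) in
        [/\ ~ dense (complexes_fin_dim R S),
            ~ closure (complexes_fin_dim R S) P &
            dist_to_set P (complexes_fin_dim R S) = 1] &
      infinite_set [set: S] ->
        complexes_fin_dim R S = isolated [set: complexes R S]].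
Proof.
split; first exact: open_complexes_dim.
  move=> Sinf P; have dP := mdist_full_fin_dim Sinf.
  have nclosure : ~ closure (complexes_fin_dim R S) P.
    move=> /(_ _ (nbhsx_ballx P 1 ltr01))[K [/dP + PK]].
    by move: PK; rewrite ballEmdist /= => /[swap] ->; rewrite ltxx.
  split => //.
    move=> /(_ (~` closure (complexes_fin_dim R S))).
    move=> /(_ (ex_intro _ P nclosure) (closed_openC (@closed_closure _ _))).
    by move=> [K [nK K_fin]]; apply/nK/subset_closure.
  rewrite /dist_to_set (_ : [set _ | _ in _] = [set 1]) ?inf1//.
  apply/seteqP; split => [_ [K /dP -> <-]//|_ ->].
  have [K K_fin] := complexes_fin_dim_neq0 R (infinite_setN0 Sinf).
  by exists K => //; exact: dP.
move=> _; apply/seteqP; split => K.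
  move=> [n _ /nbhs_complex_dim KK]; split; first by rewrite inE.
  by exists [set K] => //; rewrite setIT.
move=> [_ [V KV]]; rewrite setIT => VK; apply: fin_dim_of_nbhs.
by rewrite -VK.
Qed.
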